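(* Let $V:\mathbb{R}^n\to\mathbb{R}$ be $L$-smooth ($L>0$), convex and coercive, let $V^*:=\min_{x}V(x)$, and let $R(x^0):=\mathrm{diam}\{x\in\mathbb{R}^n : V(x)\le V(x^0)\}$. Let $(x^k)_{k\ge0}$ be the iterates, starting from $x^0\in\mathbb{R}^n$, of any one of the four methods described in the context (Gonzalez, mean value, Itoh--Abe, randomised Itoh--Abe), with time steps $(\tau_k)\subset[\tau_{\min},\tau_{\max}]$, $0<\tau_{\min}\le\tau_{\max}$, and let $\beta:=\sup_k\beta_k$ with $\beta_k$ the corresponding value given in the context. Then for all $k\ge0$ $$V_k-V^*\le\frac{\beta\,R(x^0)^2}{k+2\frac{\beta}{L}},$$ where $V_k:=\mathbb{E}[V(x^k)]$ (so $V_k=V(x^k)$ for the three deterministic methods).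
   Context: $\|\cdot\|$, $\langle\cdot,\cdot\rangle$: Euclidean norm and inner product; $S^{n-1}$: unit sphere; $e^i$: standard basis. $V$ is $L$-smooth if it is continuously differentiable and $\nabla V$ is $L$-Lipschitz. $V$ is coercive if $\{x:V(x)\le M\}$ is bounded for every $M\in\mathbb{R}$. $\mathrm{diam}(U)=\sup_{x,y\in U}\|x-y\|$. Discrete gradient methods: $x^{k+1}$ is an exact solution of $x^{k+1}=x^k-\tau_k\overline{\nabla}V(x^k,x^{k+1})$, where $\overline{\nabla}V$ is one of: (1) Gonzalez: $\overline{\nabla}V(x,y)=\nabla V(\frac{x+y}{2})+\frac{V(y)-V(x)-\langle\nabla V(\frac{x+y}{2}),y-x\rangle}{\|x-y\|^2}(y-x)$ for $x\ne y$, and $\overline{\nabla}V(x,x)=\nabla V(x)$; (2) mean value: $\overline{\nabla}V(x,y)=\int_0^1\nabla V((1-s)x+sy)\,ds$; (3) Itoh--Abe: $(\overline{\nabla}V(x,y))_i=\frac{V(y_1,\ldots,y_i,x_{i+1},\ldots,x_n)-V(y_1,\ldots,y_{i-1},x_i,\ldots,x_n)}{y_i-x_i}$, with $0/0$ interpreted as $\partial_iV(y_1,\ldots,y_{i-1},x_i,\ldots,x_n)$. (4) Randomised Itoh--Abe method: directions $d^1,d^2,\ldots\in S^{n-1}$ are drawn independently from a probability distribution $\Xi$ on $S^{n-1}$ with $\zeta:=\min_{e\in S^{n-1}}\mathbb{E}_{d\sim\Xi}[\langle d,e\rangle^2]>0$; the update is $x^{k+1}=x^k-\tau_k\alpha_kd^{k+1}$,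 where $\alpha_k\ne0$ solves $\alpha_k=-\frac{V(x^k-\tau_k\alpha_kd^{k+1})-V(x^k)}{\tau_k\alpha_k}$, and $x^{k+1}=x^k$ is considered a solution whenever $\langle\nabla V(x^k),d^{k+1}\rangle=0$. $\mathbb{E}[V(x^k)]$ is the expectation over the joint distribution of $d^1,\ldots,d^k$. Constants: $\overline{L}_i\le L$ is a Lipschitz constant of $\partial_iV:\mathbb{R}^n\to\mathbb{R}$, and $\overline{L}_{\mathrm{sum}}:=\sqrt{\sum_{i=1}^n\overline{L}_i^2}$. For $d\in S^{n-1}$, $L_d\le L$ is a constant with $|\langle\nabla V(x+\alpha d),d\rangle-\langle\nabla V(x),d\rangle|\le L_d|\alpha|$ for all $x\in\mathbb{R}^n$, $\alpha\in\mathbb{R}$; $L_{\max}\le L$ is the supremum of $L_d$ over $d$ in the support of $\Xi$. Values of $\beta_k$: Gonzalez: $2\left(\frac{1}{\tau_k}+\frac{L^2\tau_k}{2}\right)$; mean value: $2\left(\frac{1}{\tau_k}+\frac{L^2\tau_k}{4}\right)$; Itoh--Abe: $2\left(\frac1{\tau_k}+\overline{L}_{\mathrm{sum}}^2\tau_k\right)$; randomised Itoh--Abe: $\frac{\tau_k}{\zeta}\left(\frac1{\tau_k}+\frac{L_{\max}}{2}\right)^2$. *)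

(* Defs.v *)
From HB Require Import structures.
From mathcomp Require Import all_boot all_order all_algebra.
From mathcomp Require Import all_classical all_reals all_analysis.

Set Implicit Arguments.
Unset Strict Implicit.
Unset Printing Implicit Defensive.

Import Order.TTheory GRing.Theory Num.Theory.
Import numFieldNormedType.Exports.

Local Open Scope classical_set_scope.
Local Open Scope ring_scope.

(* The norm that the library puts on 'rV[R]_n is the sup norm, hence the
   separate Euclidean norm. Topological notions (differentiability, continuity,
   boundedness, open sets) do not depend on the choice of norm. *)
Definition dotp (R : realType) (n : nat) (u v : 'rV[R]_n) : R :=
  \sum_(i < n) u 0 i * v 0 i.

Definition enorm (R : realType) (n : nat) (u : 'rV[R]_n) : R :=
  Num.sqrt (dotp u u).

Definition usphere (R : realType) (n : nat) : set 'rV[R]_n :=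
  [set d | enorm d = 1].

Definition diam (R : realType) (n : nat) (U : set 'rV[R]_n) : R :=
  sup [set enorm (p.1 - p.2) | p in U `*` U].

(* The value is 0 when A has no least element. *)
Definition minimum (R : realType) (A : set R) : R := xget 0 (A `&` lbound A).

Definition partial (R : realType) (n : nat) (V : 'rV[R]_n -> R) (i : 'I_n)
    (x : 'rV[R]_n) : R :=
  'D_(delta_mx 0 i) V x.

Definition grad (R : realType) (n : nat) (V : 'rV[R]_n -> R) (x : 'rV[R]_n) :
    'rV[R]_n :=
  \row_(i < n) partial V i x.

Definition smooth (R : realType) (n : nat) (L : R) (V : 'rV[R]_n -> R) : Prop :=
  [/\ forall x, differentiable V x,
      continuous (grad V) &
      forall x y, enorm (grad V x - grad V y) <= L * enorm (x - y)].

Definition coercive (R : realType) (n : nat) (V : 'rV[R]_n -> R) : Prop :=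
  forall M : R, bounded_set [set x | V x <= M].

Definition gonzalez (R : realType) (n : nat) (V : 'rV[R]_n -> R)
    (x y : 'rV[R]_n) : 'rV[R]_n :=
  if x == y then grad V x else
  let g := grad V (2^-1 *: (x + y)) in
  g + ((V y - V x - dotp g (y - x)) / enorm (x - y) ^+ 2) *: (y - x).

Definition mean_value (R : realType) (n : nat) (V : 'rV[R]_n -> R)
    (x y : 'rV[R]_n) : 'rV[R]_n :=
  \row_(i < n)
    \int[@lebesgue_measure R]_(s in `[0, 1]) partial V i ((1 - s) *: x + s *: y).

(* (y_1, ..., y_i, x_{i+1}, ..., x_n) *)
Definition ia_point (R : realType) (n : nat) (x y : 'rV[R]_n) (i : nat) :
    'rV[R]_n :=
  \row_(j < n) (if (j < i)%N then y 0 j else x 0 j).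

Definition itoh_abe (R : realType) (n : nat) (V : 'rV[R]_n -> R)
    (x y : 'rV[R]_n) : 'rV[R]_n :=
  \row_(i < n)
    (if y 0 i == x 0 i then partial V i (ia_point x y i)
     else (V (ia_point x y i.+1) - V (ia_point x y i)) / (y 0 i - x 0 i)).

Definition dg_iterates (R : realType) (n : nat)
    (dg : 'rV[R]_n -> 'rV[R]_n -> 'rV[R]_n) (tau : nat -> R)
    (x0 : 'rV[R]_n) (x : nat -> 'rV[R]_n) : Prop :=
  x 0%N = x0 /\ forall k, x k.+1 = x k - tau k *: dg (x k) (x k.+1).

(* R^n with its Borel sigma-algebra. *)
Notation borel_rV R n := (g_sigma_algebraType (@open 'rV[R]_n)).

Definition msupport (R : realType) (n : nat) (Xi : probability (borel_rV R n) R) :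
    set 'rV[R]_n :=
  [set d | forall U : set 'rV[R]_n, open U -> U d -> (0 < Xi U)%E].

Definition zeta (R : realType) (n : nat) (Xi : probability (borel_rV R n) R) : R :=
  minimum [set fine 'E_Xi[fun d : borel_rV R n => dotp d e ^+ 2]
          | e in @usphere R n].

Definition mutually_independent (disp disp' : measure_display)
    (Omega : measurableType disp) (T : measurableType disp') (R : realType)
    (P : probability Omega R) (X : nat -> Omega -> T) : Prop :=
  forall (s : seq nat) (A : nat -> set T),
    uniq s -> (forall i, i \in s -> measurable (A i)) ->
    P (\bigcap_(i in [set` s]) (X i @^-1` A i)) =
    (\prod_(i <- s) P (X i @^-1` A i))%E.

Definition ria_step (R : realType) (n : nat) (V : 'rV[R]_n -> R) (t : R)
    (d x x' : 'rV[R]_n) : Prop :=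
  (exists alpha : R,
     [/\ alpha != 0,
         alpha = - ((V (x - (t * alpha) *: d) - V x) / (t * alpha)) &
         x' = x - (t * alpha) *: d])
  \/ (dotp (grad V x) d = 0 /\ x' = x).

(* dir k is the direction d^{k+1}. The second clause says that x k depends
   (measurably) on d^1, ..., d^k only. *)
Definition ria_iterates (disp : measure_display) (Omega : measurableType disp)
    (R : realType) (n : nat) (V : 'rV[R]_n -> R) (tau : nat -> R)
    (dir : nat -> Omega -> borel_rV R n) (x0 : 'rV[R]_n)
    (x : nat -> Omega -> borel_rV R n) : Prop :=
  [/\ forall w, x 0%N w = x0,
      forall k A, measurable A ->
        g_sigma_preimage (fun i : 'I_k => dir i) (x k @^-1` A) &
      forall k w, ria_step V (tau k) (dir k w) (x k w) (x k.+1 w)].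

Definition beta_gonzalez (R : realType) (L : R) (tau : nat -> R) (k : nat) : R :=
  2 * ((tau k)^-1 + L ^+ 2 * tau k / 2).

Definition beta_mean_value (R : realType) (L : R) (tau : nat -> R) (k : nat) : R :=
  2 * ((tau k)^-1 + L ^+ 2 * tau k / 4).

Definition beta_itoh_abe (R : realType) (Lsum : R) (tau : nat -> R) (k : nat) : R :=
  2 * ((tau k)^-1 + Lsum ^+ 2 * tau k).

Definition beta_ria (R : realType) (z Lmax : R) (tau : nat -> R) (k : nat) : R :=
  tau k / z * ((tau k)^-1 + Lmax / 2) ^+ 2.

Definition rate (R : realType) (L D : R) (beta_ : nat -> R) (k : nat) : R :=
  let beta := sup (range beta_) in
  beta * D ^+ 2 / (k%:R + 2 * (beta / L)).

(* Main.v *)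
(* All four methods satisfy |grad V(x^k)|^2 <= beta_k (V(x^k) - V(x^(k+1))): in
   the deterministic case because the discrete gradient g satisfies
   V(x^k) - V(x^(k+1)) = tau_k |g|^2 and differs from grad V(x^k) by O(|x^(k+1) -
   x^k|), and in the randomised case after averaging over d^(k+1), which is
   independent of x^k. Convexity gives V(x^k) - V* <= |grad V(x^k)| D, so
   a_k := E[V(x^k)] - V* satisfies a_k^2 <= beta D^2 (a_k - a_(k+1)) (by Jensen's
   inequality in the randomised case). As a_0 <= L D^2 / 2 by smoothness at the
   minimiser, induction on k yields the rate. *)

Require Import Defs.
From HB Require Import structures.
From mathcomp Require Import all_boot all_order all_algebra.
From mathcomp Require Import all_classical all_reals all_analysis.
From mathcomp Require Import measurable_realfun ring lra.

Set Implicit Arguments.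
Unset Strict Implicit.
Unset Printing Implicit Defensive.

Import Order.TTheory GRing.Theory Num.Theory.
Import numFieldNormedType.Exports.

Local Open Scope classical_set_scope.
Local Open Scope ring_scope.

(** Each deterministic method enters only through a constant [K] with
    [|g - grad V x|^2 <= K |x' - x|^2], which yields [beta_k = 2 (1 / tau_k + K tau_k)]: [K] is
    [L^2 / 2] for Gonzalez, [L^2 / 4] for the mean value and [Lsum^2] for Itoh-Abe. The offset
    [2 beta / L] is the one for which the invariant [a_k (k + 2 beta / L) <= beta D^2] reads
    [a_0 <= L D^2 / 2] at [k = 0]. The randomised method has two obstacles. The constant [Lmax]
    governs only directions in the support of [Xi], so its estimate holds almost surely, once the
    complement of the support is known to be null. And independence is given on finite families of
    events only: it is extended to the sigma-algebra of the past, so that the law of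
    [(x^k, d^(k+1))] is a product and Tonelli's theorem applies. The function averaged is
    [D^2 <grad V(x^k), d>^2]; being nonnegative, it needs no integrability proof, and its mean over
    [d] is at least [zeta D^2 |grad V(x^k)|^2], the origin of [1 / zeta] in [beta_k]. *)

Section dotp_theory.
Context {R : realType} {n : nat}.
Implicit Types (u v w : 'rV[R]_n) (a : R).

Lemma dotpC u v : dotp u v = dotp v u.
Proof. by apply: eq_bigr => i _; rewrite mulrC. Qed.

Lemma dotpDl u v w : dotp (u + v) w = dotp u w + dotp v w.
Proof. by rewrite -big_split; apply: eq_bigr => i _; rewrite mxE mulrDl. Qed.

Lemma dotpZl a u v : dotp (a *: u) v = a * dotp u v.
Proof. by rewrite mulr_sumr; apply: eq_bigr => i _; rewrite mxE mulrA. Qed.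

Lemma dotpNl u v : dotp (- u) v = - dotp u v.
Proof. by rewrite -scaleN1r dotpZl mulN1r. Qed.

Lemma dotpBl u v w : dotp (u - v) w = dotp u w - dotp v w.
Proof. by rewrite dotpDl dotpNl. Qed.

Lemma dotpDr u v w : dotp u (v + w) = dotp u v + dotp u w.
Proof. by rewrite dotpC dotpDl !(dotpC _ u). Qed.

Lemma dotpZr a u v : dotp u (a *: v) = a * dotp u v.
Proof. by rewrite dotpC dotpZl dotpC. Qed.

Lemma dotpNr u v : dotp u (- v) = - dotp u v.
Proof. by rewrite dotpC dotpNl dotpC. Qed.

Lemma dotp0l u : dotp 0 u = 0.
Proof. by rewrite -(scale0r 0) dotpZl mul0r. Qed.

Lemma dotp0r u : dotp u 0 = 0.
Proof. by rewrite dotpC dotp0l. Qed.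

Definition dotpE := (dotpDl, dotpDr, dotpNl, dotpNr, dotpZl, dotpZr).

Lemma dotp_ge0 u : 0 <= dotp u u.
Proof. by apply: sumr_ge0 => i _; rewrite -expr2 sqr_ge0. Qed.

Lemma dotp_eq0 u : dotp u u = 0 -> u = 0.
Proof.
move=> u0; have /psumr_eq0P := u0.
move=> /(_ (fun i _ => _)) h; apply/rowP => i; rewrite mxE.
have : u 0 i * u 0 i = 0 by apply: h => // j; rewrite -expr2 sqr_ge0.
by move/eqP; rewrite mulf_eq0 orbb => /eqP.
Qed.

Lemma enorm_ge0 u : 0 <= enorm u. Proof. exact: sqrtr_ge0. Qed.

Lemma sqr_enorm u : enorm u ^+ 2 = dotp u u.
Proof. by rewrite sqr_sqrtr// dotp_ge0. Qed.

Lemma enormZ a u : enorm (a *: u) = `|a| * enorm u.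
Proof.
by rewrite /enorm !dotpE mulrA -expr2 sqrtrM ?sqr_ge0// sqrtr_sqr.
Qed.

Lemma enormN u : enorm (- u) = enorm u.
Proof. by rewrite -scaleN1r enormZ normrN1 mul1r. Qed.

Lemma enormB u v : enorm (u - v) = enorm (v - u).
Proof. by rewrite -enormN opprB. Qed.

(** For nonzero [v], the squared norm of [<v,v> u - <u,v> v] is [<v,v>] times the difference of the
    two sides. *)
Lemma CauchySchwarz_sqr_dotp u v : dotp u v ^+ 2 <= dotp u u * dotp v v.
Proof.
have := dotp_ge0 v; rewrite le_eqVlt => /predU1P[v0|v0].
  have /esym/dotp_eq0 -> := v0.
  by rewrite !dotp0r mulr0 expr0n.
have := dotp_ge0 (dotp v v *: u - dotp u v *: v).
rewrite !dotpE (dotpC v u) => h.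
rewrite -subr_ge0 -(pmulr_rge0 _ v0); apply: le_trans h _.
by rewrite le_eqVlt; apply/orP; left; apply/eqP; ring.
Qed.

Lemma CauchySchwarz_dotp u v : `|dotp u v| <= enorm u * enorm v.
Proof.
rewrite -(@ler_pXn2r _ 2)// ?nnegrE ?mulr_ge0 ?enorm_ge0//.
by rewrite real_normK ?num_real// exprMn !sqr_enorm CauchySchwarz_sqr_dotp.
Qed.

Lemma enorm_le_of_coord u (M : R) : 0 <= M ->
  (forall i, `|u 0 i| <= M) -> enorm u <= Num.sqrt (n%:R * M ^+ 2).
Proof.
move=> M0 uM; rewrite ler_wsqrtr// /dotp.
rewrite -[X in X%:R * _](card_ord n) mulr_natl -sumr_const.
apply: ler_sum => i _; rewrite -expr2 -real_normK ?num_real//.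
by rewrite ler_pXn2r// nnegrE.
Qed.

End dotp_theory.

(** * First-order expansion along a line *)

Section line.
Context {R : realType} {n : nat}.
Variable V : 'rV[R]_n -> R.

Lemma dotp_grad x v : differentiable V x -> dotp (grad V x) v = 'd V x v.
Proof.
move=> dV; rewrite [in RHS](row_sum_delta v) linear_sum; apply: eq_bigr => i _.
by rewrite linearZ /= mxE /partial deriveE// mulrC.
Qed.

Lemma is_derive_line (x v : 'rV[R]_n) (t : R) : differentiable V (x + t *: v) ->
  is_derive t 1 (fun s : R => V (x + s *: v)) (dotp (grad V (x + t *: v)) v).
Proof.
move=> dV.
have dl : is_diff t (cst x + *:%R ^~ v) (0 + *:%R ^~ v) by exact: is_diffD.
have dV' : is_diff (x + t *: v) V ('d V (x + t *: v)) by exact: DiffDef.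
have dc := @is_diff_comp _ _ _ _ _ _ _ _ _ dl dV'.
apply: DeriveDef; first by apply/derivable1_diffP; case: dc.
rewrite deriveE; last by case: dc.
rewrite dotp_grad// -[LHS]/('d (V \o (cst x + *:%R ^~ v)) t 1).
by rewrite (@diff_val _ _ _ _ _ _ _ dc) /= !fctE add0r scale1r.
Qed.

(** Asking for the Lipschitz bound only along the segment lets the lemma serve both the global
    constant [L] and the directional constants [Ld]. *)
Lemma first_order_remainder_le (x v : 'rV[R]_n) (c : R) :
  (forall y, differentiable V y) ->
  (forall s : R, 0 <= s -> s <= 1 ->
    `|dotp (grad V (x + s *: v)) v - dotp (grad V x) v| <= c * s) ->
  `|V (x + v) - V x - dotp (grad V x) v| <= c / 2.
Proof.
move=> dV h; set g := dotp (grad V x) v.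
(* Mean value theorem for [s |-> V (x + s v) - s g - e s^2 / 2], whose
   derivative has a constant sign on [0, 1] for [e = c] and for [e = - c]. *)
have MV (e : R) : exists2 s : R, 0 <= s <= 1 &
    V (x + v) - V x - g - e / 2 = dotp (grad V (x + s *: v)) v - g - e * s.
  pose f := fun s : R => V (x + s *: v) - s * g - e / 2 * s ^+ 2.
  have df (s : R) :
      is_derive s 1 f (dotp (grad V (x + s *: v)) v - g - e * s).
    have ? := is_derive_line (dV (x + s *: v)).
    apply: is_derive_eq => /=.
    by set w := dotp (grad V _) v; rewrite /GRing.scale /=; field.
  have fc : {within `[0, 1], continuous f}.
    apply: continuous_subspaceT => s; apply: differentiable_continuous.
    by apply/derivable1_diffP; case: (df s).
  have [s s01 E] := MVT_segment ler01 (fun s _ => df s) fc.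
  exists s; first by move: s01; rewrite in_itv.
  by move: E; rewrite /f subr0 mulr1 scale1r scale0r addr0 => <-; ring.
rewrite ler_norml; apply/andP; split.
- have [s /andP[s0 s1]] := MV (- c).
  by have := h s s0 s1; rewrite -/g ler_norml => /andP[]; lra.
- have [s /andP[s0 s1]] := MV c.
  by have := h s s0 s1; rewrite -/g ler_norml => /andP[]; lra.
Qed.

End line.

Lemma minimum_attained {R : realType} (A : set R) (m : R) :
  A m -> lbound A m -> minimum A = m.
Proof.
move=> Am lm; apply: xget_unique => // y [Ay ly].
by apply/eqP; rewrite eq_le lm// ly.
Qed.

(** The default value of [minimum] is 0, so a nonzero value certifies that the minimum is attained;
    this is how [0 < zeta Xi] is exploited. *)
Lemma minimum_neq0 {R : realType} (A : set R) : minimum A != 0 ->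
  A (minimum A) /\ lbound A (minimum A).
Proof. by rewrite /minimum; case: xgetP => [y -> //|_ /eqP]. Qed.

(** Replaces the limit [t -> 0] in first-order conditions: an inequality with a quadratic remainder,
    divided by [t], takes the form [0 <= a + t c]. *)
Lemma affine_ge0_near0 {R : realFieldType} (a c : R) :
  (forall t : R, 0 < t -> t <= 1 -> 0 <= a + t * c) -> 0 <= a.
Proof.
move=> h; rewrite leNgt; apply/negP => a0.
have c0 := normr_ge0 c; have cc := ler_norm c.
have d0 : 0 < 2 * (`|c| + 1) - a by lra.
(* With [d = 2 (|c| + 1) - a], the choice [t = - a / d] gives [d (a + t c) = a (2 (|c| + 1) - a - c)
   < 0], whatever the sign of [c]. *)
have t0 : 0 < - a / (2 * (`|c| + 1) - a) by rewrite divr_gt0//; lra.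
have t1 : - a / (2 * (`|c| + 1) - a) <= 1 by rewrite ler_pdivrMr//; lra.
have := h _ t0 t1; apply/negP; rewrite -ltNge.
rewrite -(pmulr_rlt0 _ d0) mulrDr mulrCA !mulrA mulfVK ?gt_eqF//; nra.
Qed.

(** * Smooth, convex and coercive functions *)

Section smooth_convex.
Context {R : realType} {n : nat}.
Variables (V : 'rV[R]_n -> R) (L : R).
Hypothesis V_smooth : smooth L V.
Implicit Types (x y v : 'rV[R]_n).

Lemma smooth_continuous : continuous V.
Proof.
by have [dV _ _] := V_smooth; move=> x; exact: differentiable_continuous.
Qed.

Lemma smooth_remainder x v :
  `|V (x + v) - V x - dotp (grad V x) v| <= L * dotp v v / 2.
Proof.
have [dV _ gL] := V_smooth; apply: first_order_remainder_le => // s s0 s1.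
rewrite -dotpBl (le_trans (CauchySchwarz_dotp _ _))//.
apply: (@le_trans _ _ (L * enorm (x + s *: v - x) * enorm v)).
  by rewrite ler_wpM2r ?enorm_ge0.
by rewrite addrC addKr enormZ ger0_norm// -sqr_enorm le_eqVlt; apply/orP; left;
  apply/eqP; ring.
Qed.

Lemma gap_le_sqr_dist x y : (forall z, V x <= V z) ->
  V y - V x <= L / 2 * dotp (y - x) (y - x).
Proof.
move=> Vx; suff g0 : 0 <= dotp (grad V x) (x - y).
  have := smooth_remainder x (y - x); rewrite addrCA subrr addr0.
  rewrite -(opprB y x) dotpNr in g0.
  by rewrite ler_norml => /andP[_]; lra.
apply: (@affine_ge0_near0 _ _ (L / 2 * dotp (x - y) (x - y))) => t t0 t1.
have := smooth_remainder x (t *: (x - y)).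
rewrite ler_norml !dotpE => /andP[_].
have := Vx (x + t *: (x - y)) => h1 h2.
rewrite -(pmulr_rge0 _ t0).
nra.
Qed.

Hypothesis V_convex : convex_function [set: 'rV[R]_n] V.

(** Convexity bounds [V (x + t (y - x))] from above, and [smooth_remainder] bounds it from below up
    to [O(t^2)]; compare, divide by [t] and let [t] tend to 0. *)
Lemma convex_grad_le x y : V x + dotp (grad V x) (y - x) <= V y.
Proof.
suff : 0 <= V y - V x - dotp (grad V x) (y - x) by lra.
apply: (@affine_ge0_near0 _ _ (L / 2 * dotp (y - x) (y - x))) => t t0 t1.
have := smooth_remainder x (t *: (y - x)).
rewrite ler_norml dotpZr dotpZl dotpZr => /andP[+ _].
have : V (x + t *: (y - x)) <= t * V y + (1 - t) * V x.
  have -> : x + t *: (y - x) = t *: y + (1 - t) *: x.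
    by rewrite scalerBr scalerBl scale1r addrCA.
  exact: (V_convex (Itv01 (ltW t0) t1) (in_setT y) (in_setT x)).
move=> h1 h2; rewrite -(pmulr_rge0 _ t0); nra.
Qed.

Hypothesis V_coercive : coercive V.

(** The sublevel set of [V 0] is compact by coercivity, and a minimiser on it is global since [V]
    exceeds [V 0] elsewhere. *)
Lemma minimizer_exists : exists2 x, forall y, V x <= V y &
  minimum (range V) = V x.
Proof.
pose S := [set x | V x <= V 0].
have cS : compact S.
  apply: bounded_closed_compact; first exact: V_coercive.
  by apply: closed_comp (@closed_le R (V 0)) => x _; exact: smooth_continuous.
have [||x /set_mem xS xmin] := @EVT_min_rV R n V S _ cS _.
- by exists 0; rewrite /S /=.
- exact/continuous_subspaceT/smooth_continuous.
have Vx y : V x <= V y.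
  have [yS|/ltW yS] := leP (V y) (V 0); first by apply: xmin; rewrite inE.
  exact: le_trans yS.
by exists x => //; apply: minimum_attained => [|_ [y _ <-]//]; exists x.
Qed.

(** Coercivity is what makes the [sup] in [diam] an upper bound: a sublevel set is bounded in the
    sup norm, hence coordinatewise, hence in the Euclidean norm. *)
Lemma dist_le_diam (M : R) x y : V x <= M -> V y <= M ->
  enorm (x - y) <= diam [set z | V z <= M].
Proof.
move=> xM yM; apply: ub_le_sup; last by exists (x, y).
(* [bounded_set] bounds the set by every number above [B]; [|B| + 1] is such a number and is
   nonnegative. *)
have [B [_ /(_ (`|B| + 1))]] := V_coercive M.
have B1 : B < `|B| + 1 by rewrite (le_lt_trans (ler_norm B))// ltrDl.
move=> /(_ B1) /= hB.
have B0 : 0 <= `|B| + 1 by rewrite addr_ge0.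
have cB z i : V z <= M -> `|z 0 i| <= `|B| + 1.
  move=> /hB; apply: le_trans.
  by rewrite [leRHS]/Num.norm /= mx_normrE (le_bigmax _ _ (0, i)).
exists (Num.sqrt (n%:R * (`|B| + 1 + (`|B| + 1)) ^+ 2)).
move=> _ /= [[u v] /= [uM vM] <-].
apply: enorm_le_of_coord => [|i]; first exact: addr_ge0.
by rewrite !mxE (le_trans (ler_normB _ _))// lerD// cB.
Qed.

(** Convexity towards a minimiser, which itself lies in the sublevel set of [x0], and
    Cauchy-Schwarz. The squared form is the one comparable with averages of squared directional
    derivatives. *)
Lemma sqr_gap_le x0 x : V x <= V x0 ->
  (V x - minimum (range V)) ^+ 2 <=
  diam [set z | V z <= V x0] ^+ 2 * dotp (grad V x) (grad V x).
Proof.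
move=> xx0; have [xs xsmin ->] := minimizer_exists.
have gap : V x - V xs <= diam [set z | V z <= V x0] * enorm (grad V x).
  have := convex_grad_le x xs => h.
  apply: (@le_trans _ _ (- dotp (grad V x) (xs - x))); first lra.
  rewrite (le_trans (ler_norm _))// normrN.
  rewrite (le_trans (CauchySchwarz_dotp _ _))//.
  rewrite mulrC ler_wpM2r ?enorm_ge0// dist_le_diam// (le_trans (xsmin x))//.
rewrite -sqr_enorm -exprMn ler_pXn2r ?nnegrE// ?subr_ge0//.
by rewrite (le_trans _ gap)// subr_ge0.
Qed.

End smooth_convex.

(** * The scalar recurrence and its rate *)

Section recurrence.
Context {R : realFieldType}.

(** After multiplication by [M > 0]: [M q <= p (M - p)], and [p (M - p) (c + 1) = (M - p) (p c + p)
    <= (M - p) (M + p) <= M^2]. The bound [q^2 <= M q] settles the degenerate case [M = 0]. *)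
Lemma gap_recurrence (c M p q : R) : 0 < c -> 0 <= M -> 0 <= p -> 0 <= q ->
  p ^+ 2 <= M * (p - q) -> q ^+ 2 <= M * q -> p * c <= M -> q * (c + 1) <= M.
Proof.
move=> c0; rewrite le_eqVlt => /predU1P[<- _ q0 _ |M0 p0 q0 pq _ pc].
  rewrite mul0r => q2 _; have -> : q = 0; last by rewrite mul0r.
  by apply/eqP; rewrite -sqrf_eq0 eq_le q2 sqr_ge0.
rewrite -(ler_pM2l M0).
have Mq : M * q <= p * (M - p) by nra.
have pM : p <= M.
  rewrite leNgt; apply/negP => Mp.
  have Mq0 : 0 <= M * q by rewrite mulr_ge0// ltW.
  have : p * (M - p) < 0 by rewrite pmulr_rlt0//; lra.
  lra.
apply: (@le_trans _ _ (p * (M - p) * (c + 1))).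
  by rewrite mulrA ler_wpM2r // addr_ge0 // ltW.
nra.
Qed.

Lemma rate_of_recurrence (L D b : R) (a : nat -> R) : 0 < L -> 0 < b ->
  (forall k, 0 <= a k) -> a 0%N <= L / 2 * D ^+ 2 ->
  (forall k, a k ^+ 2 <= b * D ^+ 2 * (a k - a k.+1)) ->
  forall k, a k <= b * D ^+ 2 / (k%:R + 2 * (b / L)).
Proof.
move=> L0 b0 a0 aD ha.
have c0 k : 0 < k%:R + 2 * (b / L).
  by rewrite ltr_wpDl // mulr_gt0 // divr_gt0.
have M0 : 0 <= b * D ^+ 2 by rewrite mulr_ge0 ?sqr_ge0// ltW.
move=> k; rewrite ler_pdivlMr//; elim: k => [|k ih].
  rewrite add0r; apply: (@le_trans _ _ (L / 2 * D ^+ 2 * (2 * (b / L)))).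
    by rewrite ler_wpM2r// mulr_ge0// divr_ge0 ?ltW.
  by rewrite le_eqVlt; apply/orP; left; apply/eqP; field; rewrite gt_eqF.
rewrite -natr1 addrAC; apply: gap_recurrence ih => //.
(* The bound on [a k.+1 ^+ 2] is the recurrence at [k.+1] with the nonnegative [a k.+2] dropped. *)
by rewrite (le_trans (ha _))// ler_wpM2l// gerBl.
Qed.

End recurrence.

Section deterministic_rate.
Context {R : realType} {n : nat}.
Variables (V : 'rV[R]_n -> R) (L : R) (x0 : 'rV[R]_n).
Hypotheses (L_gt0 : 0 < L) (V_smooth : smooth L V)
  (V_convex : convex_function [set: 'rV[R]_n] V) (V_coercive : coercive V).

Lemma initial_gap_le :
  V x0 - minimum (range V) <= L / 2 * diam [set z | V z <= V x0] ^+ 2.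
Proof.
have [xs xsmin ->] := minimizer_exists V_smooth V_coercive.
rewrite (le_trans (gap_le_sqr_dist V_smooth _ xsmin))// ler_wpM2l//.
  by rewrite divr_ge0// ltW.
rewrite -sqr_enorm; have d := dist_le_diam V_coercive (lexx (V x0)) (xsmin x0).
by rewrite ler_pXn2r ?nnegrE ?enorm_ge0// (le_trans _ d)// enorm_ge0.
Qed.

(** The decrease of [V] is used twice: it keeps the iterates in the sublevel set whose diameter is
    [D], and it gives the sign that allows [b k] to be enlarged to the supremum, an upper bound
    because the range is bounded above. *)
Lemma rate_of_sufficient_decrease (x : nat -> 'rV[R]_n) (b : nat -> R) :
  x 0%N = x0 -> (forall k, 0 < b k) -> has_ubound (range b) ->
  (forall k,
    dotp (grad V (x k)) (grad V (x k)) <= b k * (V (x k) - V (x k.+1))) ->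
  forall k, V (x k) - minimum (range V) <=
    rate L (diam [set z | V z <= V x0]) b k.
Proof.
move=> x00 b0 ub hx.
have bs k : b k <= sup (range b) by apply: ub_le_sup => //; exists k.
have Vd k : V (x k.+1) <= V (x k).
  rewrite -subr_ge0 -(pmulr_rge0 _ (b0 k)).
  exact: le_trans (dotp_ge0 _) (hx k).
have Vx0 k : V (x k) <= V x0.
  by elim: k => [|k ih]; [rewrite x00|exact: le_trans ih].
apply: rate_of_recurrence => //.
- exact: lt_le_trans (bs 0%N).
- have [xs xsmin ->] := minimizer_exists V_smooth V_coercive.
  by move=> k; rewrite subr_ge0.
- by rewrite x00; exact: initial_gap_le.
- move=> k.
  rewrite (le_trans (sqr_gap_le V_smooth V_convex V_coercive (Vx0 k)))//.
  rewrite [sup _ * _]mulrC -[leRHS]mulrA ler_wpM2l ?sqr_ge0//.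
  rewrite (le_trans (hx k))//.
  have -> : V (x k) - minimum (range V) - (V (x k.+1) - minimum (range V)) =
    V (x k) - V (x k.+1) by ring.
  by rewrite ler_wpM2r ?subr_ge0.
Qed.

End deterministic_rate.

(** * Sufficient decrease; Gonzalez and Itoh-Abe discrete gradients *)

Section discrete_gradients.
Context {R : realType} {n : nat}.
Variables (V : 'rV[R]_n -> R) (L : R).
Hypothesis V_smooth : smooth L V.
Implicit Types (x y v w g : 'rV[R]_n).

Lemma line_MVT x v : exists2 s : R, 0 <= s <= 1 &
  V (x + v) - V x = dotp (grad V (x + s *: v)) v.
Proof.
have [dV _ _] := V_smooth.
have df (s : R) := is_derive_line (dV (x + s *: v)).
have fc : {within `[0, 1], continuous (fun s : R => V (x + s *: v))}.
  apply: continuous_subspaceT => s; apply: differentiable_continuous.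
  by apply/derivable1_diffP; case: (df s).
have [s s01 E] := MVT_segment ler01 (fun s _ => df s) fc.
exists s; first by move: s01; rewrite in_itv.
by move: E; rewrite subr0 mulr1 scale1r scale0r addr0.
Qed.

(* |grad V x|^2 <= 2 |g|^2 + 2 |g - grad V x|^2, where t |g|^2 = V x - V x'. *)
Lemma sufficient_decrease (t K : R) x x' g : 0 < t -> x' = x - t *: g ->
  dotp g (x' - x) = V x' - V x ->
  dotp (g - grad V x) (g - grad V x) <= K * dotp (x' - x) (x' - x) ->
  dotp (grad V x) (grad V x) <= 2 * (t^-1 + K * t) * (V x - V x').
Proof.
move=> t0 xE mv err.
have tV : t^-1 * t = 1 by rewrite mulVf// gt_eqF.
have xx : x' - x = - (t *: g) by rewrite xE addrAC subrr add0r.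
have VE : V x - V x' = t * dotp g g.
  by rewrite -opprB -mv xx dotpNr dotpZr opprK.
move: err; rewrite {mv} xx VE !dotpE => err.
(* [|2 g - grad V x|^2] is exactly the slack in [|grad V x|^2 <= 2 |g|^2 + 2 |g - grad V x|^2]. *)
have := dotp_ge0 (2 *: g - grad V x); rewrite !dotpE => h.
rewrite (dotpC _ g) in h err *.
have -> : 2 * (t^-1 + K * t) * (t * dotp g g) =
   2 * (t^-1 * t) * dotp g g + 2 * K * t * t * dotp g g by ring.
rewrite tV; lra.
Qed.

Lemma sqr_grad_lipschitz x y :
  dotp (grad V x - grad V y) (grad V x - grad V y) <=
  L ^+ 2 * dotp (x - y) (x - y).
Proof.
have [_ _ /(_ x y) gL] := V_smooth.
by rewrite -!sqr_enorm -exprMn ler_pXn2r ?nnegrE ?enorm_ge0//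
  (le_trans _ gL) ?enorm_ge0.
Qed.

Lemma gonzalez_mean_value x y : dotp (gonzalez V x y) (y - x) = V y - V x.
Proof.
rewrite /gonzalez; have [->|xy] := eqVneq; first by rewrite !subrr dotp0r.
rewrite dotpDl dotpZl enormB sqr_enorm divfK; first by rewrite addrC subrK.
by apply: contra_neq xy => /dotp_eq0/eqP; rewrite subr_eq0 => /eqP.
Qed.

(* With v = y - x, h = grad V ((x + y) / 2) - grad V x and r = <e, v>, the error
   e = h + c v has |e|^2 = (|h|^2 - <h, v>^2 / |v|^2) + r^2 / |v|^2, and each of
   the two terms is at most L^2 |v|^2 / 4. *)
Lemma gonzalez_error x y :
  dotp (gonzalez V x y - grad V x) (gonzalez V x y - grad V x) <=
  L ^+ 2 / 2 * dotp (y - x) (y - x).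
Proof.
have [->|xy] := eqVneq x y.
  by rewrite /gonzalez eqxx !subrr !dotp0r mulr0.
set v := y - x; set e := gonzalez V x y - grad V x.
set h := grad V (2^-1 *: (x + y)) - grad V x.
have [N0|N0] := eqVneq (dotp v v) 0.
  by move/dotp_eq0/eqP: N0; rewrite subr_eq0 eq_sym (negPf xy).
have {N0} Np : 0 < dotp v v by rewrite lt_neqAle eq_sym N0 dotp_ge0.
have hh : dotp h h <= L ^+ 2 / 4 * dotp v v.
  have := sqr_grad_lipschitz (2^-1 *: (x + y)) x.
  have -> : 2^-1 *: (x + y) - x = 2^-1 *: v.
    by apply/rowP => j; rewrite !mxE; field.
  rewrite dotpZl dotpZr -/h => /le_trans; apply.
  by rewrite le_eqVlt; apply/orP; left; apply/eqP; field.
pose c := (V y - V x - dotp (grad V (2^-1 *: (x + y))) v) / enorm (x - y) ^+ 2.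
have eE : e = h + c *: v.
  by rewrite /e /gonzalez (negPf xy) /= -/v -/c addrAC.
have rL : `|dotp e v| <= L * dotp v v / 2.
  (* By the mean value property, [<e, v>] is the first-order Taylor remainder of [V] at [x]. *)
  have -> : dotp e v = V (x + v) - V x - dotp (grad V x) v.
    by rewrite /e dotpBl gonzalez_mean_value /v addrCA subrr addr0.
  exact: smooth_remainder.
clearbody e h v c; move: rL; rewrite {}eE !dotpE (dotpC v h).
set r := _ + c * dotp v v => rL.
have r2 : r ^+ 2 <= L ^+ 2 / 4 * dotp v v ^+ 2.
  rewrite -(real_normK (num_real r)).
  have -> : L ^+ 2 / 4 * dotp v v ^+ 2 = (L * dotp v v / 2) ^+ 2 by field.
  by rewrite ler_pXn2r// nnegrE (le_trans _ rL).
rewrite -(ler_pM2l Np).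
have := sqr_ge0 (dotp h v).
have -> : dotp v v * (dotp h h + c * dotp h v +
    (c * dotp h v + c * (c * dotp v v))) =
  dotp v v * dotp h h + r ^+ 2 - dotp h v ^+ 2 by rewrite /r; ring.
nra.
Qed.

Lemma ia_point0 x y : ia_point x y 0 = x.
Proof. by apply/rowP => j; rewrite mxE. Qed.

Lemma ia_pointn x y : ia_point x y n = y.
Proof. by apply/rowP => j; rewrite mxE ltn_ord. Qed.

Lemma ia_pointS x y (i : 'I_n) :
  ia_point x y i.+1 = ia_point x y i + (y 0 i - x 0 i) *: delta_mx 0 i.
Proof.
apply/rowP => j; rewrite !mxE eqxx /= ltnS.
have [->|ji] := eqVneq j i; first by rewrite leqnn ltnn mulr1 addrC subrK.
by rewrite mulr0 addr0 leq_eqVlt val_eqE (negPf ji).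
Qed.

(** Each term is the increment of [V] along one leg of the staircase from [x] to [y], and the legs
    telescope; a leg with [y_i = x_i] contributes 0 on both sides. *)
Lemma itoh_abe_mean_value x y : dotp (itoh_abe V x y) (y - x) = V y - V x.
Proof.
have := telescope_sumr (fun i => V (ia_point x y i)) (leq0n n).
rewrite /= ia_point0 ia_pointn big_mkord => <-.
apply: eq_bigr => i _; rewrite !mxE.
case: (eqVneq (y 0 i) (x 0 i)) => [yx|yx]; last by rewrite divfK// subr_eq0.
by rewrite ia_pointS yx subrr scale0r addr0 mulr0 subrr.
Qed.

(** [z] comes from the mean value theorem on the [i]-th leg of the staircase. That leg stays in the
    box spanned by [x] and [y], so no coordinate of [z - x] exceeds that of [y - x] in absolute
    value. *)
Lemma itoh_abe_coord x y i : exists2 z, itoh_abe V x y 0 i = partial V i z &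
  enorm (z - x) <= enorm (y - x).
Proof.
have key (s : R) : 0 <= s <= 1 ->
  enorm (ia_point x y i + s *: ((y 0 i - x 0 i) *: delta_mx 0 i) - x) <=
  enorm (y - x).
  move=> /andP[s0 s1]; rewrite ler_wsqrtr//; apply: ler_sum => j _.
  rewrite !mxE eqxx /=; have := sqr_ge0 (y 0 j - x 0 j).
  have [->|ji] := eqVneq j i.
    rewrite ltnn mulr1 addrAC subrr add0r mulrACA -expr2 => d2.
    by rewrite -[leRHS]mul1r ler_wpM2r// mulr_ile1.
  by rewrite !mulr0 addr0; case: ifP => // _ h; rewrite subrr mul0r -expr2.
rewrite /itoh_abe mxE; case: (eqVneq (y 0 i) (x 0 i)) => [yx|yx].
  exists (ia_point x y i) => //; rewrite -[ia_point x y i]addr0.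
  by rewrite -(scale0r ((y 0 i - x 0 i) *: delta_mx 0 i)) key// lexx ler01.
have [s s01 E] := line_MVT (ia_point x y i) ((y 0 i - x 0 i) *: delta_mx 0 i).
exists (ia_point x y i + s *: ((y 0 i - x 0 i) *: delta_mx 0 i)); last first.
  exact: key.
rewrite ia_pointS E dotpZr mulrC mulKf ?subr_eq0//.
rewrite /dotp (bigD1 i)//= big1 => [|j ji]; last first.
  by rewrite !mxE (negPf ji) mulr0.
by rewrite !mxE !eqxx mulr1 addr0.
Qed.

Lemma itoh_abe_error (Lbar : 'I_n -> R) x y :
  (forall i u v, `|partial V i u - partial V i v| <= Lbar i * enorm (u - v)) ->
  dotp (itoh_abe V x y - grad V x) (itoh_abe V x y - grad V x) <=
  Num.sqrt (\sum_(i < n) Lbar i ^+ 2) ^+ 2 * dotp (y - x) (y - x).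
Proof.
move=> hL; rewrite sqr_sqrtr; last by apply: sumr_ge0 => i _; exact: sqr_ge0.
rewrite mulr_suml; apply: ler_sum => i _.
have -> : (itoh_abe V x y - grad V x) 0 i =
  itoh_abe V x y 0 i - partial V i x by rewrite !mxE.
rewrite -expr2.
have [z -> zx] := itoh_abe_coord x y i.
have hi : `|partial V i z - partial V i x| <= Lbar i * enorm (y - x).
  rewrite (le_trans (hL _ _ _))//.
  (* The nonnegativity of [Lbar i] is read off from the Lipschitz bound at [z] and [x], which tells
     its sign only if these points differ. *)
  have [zx0|zx0] := eqVneq (enorm (z - x)) 0.
    by rewrite zx0 mulr0 (le_trans _ (hL i y x)).
  have zx1 : 0 < enorm (z - x) by rewrite lt_neqAle eq_sym zx0 enorm_ge0.
  by rewrite ler_wpM2l// -(pmulr_lge0 _ zx1) (le_trans _ (hL i z x)).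
rewrite -sqr_enorm -exprMn -(real_normK (num_real (_ - _))).
by rewrite ler_pXn2r// nnegrE (le_trans _ hi).
Qed.

End discrete_gradients.

(** * The mean value discrete gradient, through integrals over the unit interval *)

Section unit_interval_integral.
Context {R : realType}.
Implicit Types f F : R -> R.
Local Notation mu := (@lebesgue_measure R).
Local Notation I := `[0, 1]%classic.

Lemma continuous_integrable01 f : continuous f -> mu.-integrable I (EFin \o f).
Proof.
move=> cf; apply: continuous_compact_integrable; first exact: segment_compact.
exact: continuous_subspaceT.
Qed.

Lemma Rintegral01_derive f F : continuous f ->
  (forall s : R, is_derive s 1 F (f s)) -> \int[mu]_(s in I) f s = F 1 - F 0.
Proof.
move=> cf dF.
have cF : continuous F.
  move=> s; apply: differentiable_continuous; apply/derivable1_diffP.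
  by case: (dF s).
rewrite /Rintegral (@continuous_FTC2 _ f F)//.
- exact: continuous_subspaceT.
- split=> [s _||]; first by case: (dF s).
  + exact/cvg_at_right_filter/cF.
  + exact/cvg_at_left_filter/cF.
- by move=> s _; rewrite derive1E; case: (dF s).
Qed.

Lemma Rintegral01_sum n (f : 'I_n -> R -> R) (w : 'I_n -> R) :
  (forall i, continuous (f i)) ->
  \int[mu]_(s in I) (\sum_(i < n) f i s * w i) =
  \sum_(i < n) (\int[mu]_(s in I) f i s) * w i.
Proof.
move=> cf.
have intf i := continuous_integrable01 (cf i).
have intfw i : mu.-integrable I (fun s => (f i s * w i)%:E).
  apply: continuous_integrable01 => s; apply: cvgM; first exact: cf.
  exact: cvg_cst.
transitivity (\sum_(i < n) \int[mu]_(s in I) (f i s * w i)).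
  rewrite /Rintegral sum_fine => [|i _]; last exact: integrable_fin_num.
  by rewrite -integral_sum//; under eq_integral do rewrite -sumEFin.
by apply: eq_bigr => i _; rewrite RintegralZr.
Qed.

End unit_interval_integral.

Section mean_value_gradient.
Context {R : realType} {n : nat}.
Variables (V : 'rV[R]_n -> R) (L : R).
Hypotheses (L_gt0 : 0 < L) (V_smooth : smooth L V).
Implicit Types (x y v w : 'rV[R]_n).
Local Notation mu := (@lebesgue_measure R).

Lemma partial_line_continuous i x v :
  continuous (fun s : R => partial V i (x + s *: v)).
Proof.
have [_ cg _] := V_smooth.
have -> : (fun s : R => partial V i (x + s *: v)) =
    (fun u : 'rV[R]_n => u 0 i) \o (grad V) \o (fun s : R => x + s *: v).
  by apply/funext => s /=; rewrite mxE.
move=> s; apply: continuous_comp; last first.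
  apply: continuous_comp; first exact: cg.
  exact: coord_continuous.
by apply: cvgD; [exact: cvg_cst|exact: scalel_continuous].
Qed.

Lemma dotp_grad_line_continuous x v w :
  continuous (fun s : R => dotp (grad V (x + s *: v)) w).
Proof.
have -> : (fun s : R => dotp (grad V (x + s *: v)) w) =
    (fun s => \sum_(i < n) partial V i (x + s *: v) * w 0 i).
  by apply/funext => s; apply: eq_bigr => i _; rewrite mxE.
apply: continuous_big => [|i _ s]; first exact: add_continuous.
by apply: cvgM; [exact: partial_line_continuous|exact: cvg_cst].
Qed.

(** Pairing with a fixed vector turns the coordinatewise integral into a scalar one along the
    segment, open to the fundamental theorem of calculus and to monotonicity. *)
Lemma dotp_mean_value x y w : dotp (mean_value V x y) w =
  \int[mu]_(s in `[0, 1]) dotp (grad V (x + s *: (y - x))) w.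
Proof.
transitivity (\sum_(i < n) (\int[mu]_(s in `[0, 1])
    partial V i (x + s *: (y - x))) * w 0 i).
  apply: eq_bigr => i _; congr (_ * _).
  rewrite mxE.
  apply: eq_Rintegral => s _.
  congr (partial V i _).
  by rewrite scalerBr scalerBl scale1r addrAC addrA.
rewrite -Rintegral01_sum => [|i]; last exact: partial_line_continuous.
by apply: eq_Rintegral => s _; apply: eq_bigr => i _; rewrite mxE.
Qed.

Lemma mean_value_mean_value x y : dotp (mean_value V x y) (y - x) = V y - V x.
Proof.
have [dV _ _] := V_smooth; rewrite dotp_mean_value.
rewrite (Rintegral01_derive (@dotp_grad_line_continuous x (y - x) (y - x))
  (fun s => is_derive_line (dV (x + s *: (y - x))))).
by rewrite scale1r scale0r addr0 addrCA subrr addr0.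
Qed.

(** The error [e] is tested against itself: [|e|^2] is the integral of [<grad V (x + s v) - grad V
    x, e> <= L s |v| |e|], hence at most [L / 2 |v| |e|]; then [|e|] is cancelled. *)
Lemma mean_value_error x y :
  dotp (mean_value V x y - grad V x) (mean_value V x y - grad V x) <=
  L ^+ 2 / 4 * dotp (y - x) (y - x).
Proof.
have [_ _ gL] := V_smooth.
set v := y - x; set e := mean_value V x y - grad V x.
pose a := dotp (grad V x) e; pose b := L * enorm v * enorm e.
have caff : continuous (fun s : R => a + b * s).
  by move=> s; apply: cvgD; [exact: cvg_cst|apply: cvgM => //; exact: cvg_cst].
have intaff : \int[mu]_(s in `[0, 1]) (a + b * s) = a + b / 2.
  have dF (s : R) :
      is_derive s 1 (fun s : R => a * s + b / 2 * s ^+ 2) (a + b * s).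
    by apply: is_derive_eq => /=; rewrite /GRing.scale /=; field.
  by rewrite (Rintegral01_derive caff dF); ring.
have ee : enorm e * enorm e <= L / 2 * enorm v * enorm e.
  rewrite -expr2 sqr_enorm {1}/e dotpBl dotp_mean_value.
  have : \int[mu]_(s in `[0, 1]) dotp (grad V (x + s *: v)) e <=
         \int[mu]_(s in `[0, 1]) (a + b * s).
    apply: le_Rintegral => //.
    - exact/continuous_integrable01/dotp_grad_line_continuous.
    - exact: continuous_integrable01.
    move=> s /=; rewrite in_itv/= => /andP[s0 s1].
    rewrite -lerBlDl /a -dotpBl (le_trans (ler_norm _))//.
    rewrite (le_trans (CauchySchwarz_dotp _ _))// /b mulrAC.
    rewrite ler_wpM2r ?enorm_ge0//.
    rewrite (le_trans (gL _ _))// [x + _]addrC addrK enormZ ger0_norm//.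
    by rewrite mulrA mulrAC.
  rewrite intaff -/v -/a /b; lra.
rewrite -!sqr_enorm.
have -> : L ^+ 2 / 4 * enorm v ^+ 2 = (L / 2 * enorm v) ^+ 2 by field.
rewrite ler_pXn2r ?nnegrE ?mulr_ge0 ?divr_ge0 ?enorm_ge0 ?(ltW L_gt0)//.
have := enorm_ge0 e; rewrite le_eqVlt => /predU1P[<-|e0].
  by rewrite !mulr_ge0 ?enorm_ge0 ?invr_ge0 ?(ltW L_gt0).
by rewrite -(ler_pM2r e0).
Qed.

End mean_value_gradient.

(** * Independence of a direction from the past, and product laws *)

Lemma set_iota0 (m i : nat) : [set` iota 0 m] i = (i < m)%N :> Prop.
Proof. by rewrite -[LHS]/(is_true (i \in iota 0 m)) mem_iota add0n. Qed.

Section independence.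
Context {disp disp' : measure_display} {Omega : measurableType disp}
  {T : measurableType disp'} {R : realType} (P : probability Omega R)
  (X : nat -> Omega -> T).
Hypothesis mX : forall i, measurable_fun setT (X i).

(** Rectangles in the first [k] variables: a pi-system that generates their sigma-algebra and on
    which mutual independence speaks directly. *)
Let cyl k : set (set Omega) := [set E | exists A : nat -> set T,
  (forall i, measurable (A i)) /\
  E = \bigcap_(i in [set` iota 0 k]) X i @^-1` A i].

Let measurable_preimage i A : measurable A -> measurable (X i @^-1` A).
Proof. by move=> mA; rewrite -[X in measurable X]setTI; exact: mX. Qed.

Let cyl_measurable k : cyl k `<=` measurable.
Proof.
move=> _ [A [mA ->]]; apply: bigcap_measurableType => i _.
exact: measurable_preimage.
Qed.

Let cyl_setI k : setI_closed (cyl k).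
Proof.
move=> _ _ [A [mA ->]] [B [mB ->]]; exists (fun i => A i `&` B i); split.
  by move=> i; exact: measurableI.
by rewrite -bigcapI.
Qed.

Let cylT k : cyl k setT.
Proof.
by exists (fun=> setT); split => //; apply/esym; rewrite -subTset => w _ i _.
Qed.

Let sub_cyl k : g_sigma_preimage (fun i : 'I_k => X i) `<=` <<s cyl k >>.
Proof.
apply: sub_smallest2r; first exact: smallest_sigma_algebra.
move=> E; have h i : preimage_set_system setT (X (i : 'I_k)) measurable E ->
    cyl k E.
  move=> [B mB <-]; exists (fun j => if j == i :> nat then B else setT); split.
    by move=> j; case: ifP.
  rewrite setTI; apply/seteqP; split => [w Bw j _ /=|w /(_ i)/=].
    by case: eqP => // ->.
  by rewrite mem_iota add0n ltn_ord eqxx; exact.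
by elim/big_ind: _ => [[]|F G hF hG [/hF|/hG]//|i _ /h].
Qed.

Lemma g_sigma_preimage_measurable k :
  g_sigma_preimage (fun i : 'I_k => X i) `<=` measurable.
Proof.
apply: subset_trans (@sub_cyl k) _.
by apply: smallest_sub; [exact: sigma_algebra_measurable|exact: cyl_measurable].
Qed.

(** As functions of [E], both sides are finite measures that agree on the pi-system [cyl k], hence
    on the sigma-algebra it generates. *)
Lemma independent_past k (E : set Omega) (B : set T) :
  mutually_independent P X -> g_sigma_preimage (fun i : 'I_k => X i) E ->
  measurable B -> P (E `&` X k @^-1` B) = (P E * P (X k @^-1` B))%E.
Proof.
move=> ind /sub_cyl sE mB; have mF := measurable_preimage k mB.
pose p : {nonneg R} := NngNum (fine_ge0 (measure_ge0 P (X k @^-1` B))).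
have pE F : mscale p P F = (P F * P (X k @^-1` B))%E.
  by rewrite /mscale /= muleC fineK// fin_num_measure.
rewrite -pE.
have -> : P (E `&` X k @^-1` B) = mrestr P mF E by [].
apply: (g_sigma_algebra_measure_unique (cyl k) (@cyl_measurable k)
  (fun=> setT)) => //.
- by rewrite bigcup_const//; exists 0%N.

- move=> _ [A [mA ->]].
  rewrite /= pE /mrestr.
  rewrite (ind (iota 0 k) A (iota_uniq _ _) (fun i _ => mA i)).
  (* Intersecting with the event on [X k] gives a rectangle in [k.+1] variables, so the independence
     hypothesis is used with [k] and with [k.+1] indices. *)
  pose A' i := if i == k then B else A i.
  have -> : \bigcap_(i in [set` iota 0 k]) X i @^-1` A i `&` X k @^-1` B =
      \bigcap_(i in [set` iota 0 k.+1]) X i @^-1` A' i.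
    apply/seteqP; split => [w [Aw Bw] i|w h].
      rewrite set_iota0 ltnS leq_eqVlt /A' => /orP[/eqP ->|ik].
        by rewrite eqxx.
      by rewrite (ltn_eqF ik); apply: Aw; rewrite set_iota0.
    split=> [i|].
      rewrite set_iota0 => ik.
      have := h i; rewrite set_iota0 ltnS (ltnW ik).
      by rewrite /A' (ltn_eqF ik); exact.
    by have := h k; rewrite set_iota0 ltnSn /A' eqxx; exact.
  rewrite ind ?iota_uniq//; last by move=> i _; rewrite /A'; case: ifP.
  rewrite -[in LHS]addn1 iotaD big_cat big_seq1 add0n /= {2}/A' eqxx.
  congr (_ * _)%E; apply: eq_big_seq => i.
  by rewrite mem_iota add0n /A' => /andP[_ ik]; rewrite ltn_eqF.
- move=> _; change (P (setT `&` X k @^-1` B) < +oo)%E.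
  by rewrite setTI (le_lt_trans (probability_le1 _ mF))// ltry.
Qed.

End independence.

Section independent_pair.
Local Open Scope ereal_scope.
Context {d d1 d2 : measure_display} {Omega : measurableType d}
  {T1 : measurableType d1} {T2 : measurableType d2} {R : realType}
  (P : probability Omega R) (Q : probability T2 R)
  (X : Omega -> T1) (Y : Omega -> T2).
Hypotheses (mX : measurable_fun setT X) (mY : measurable_fun setT Y)
  (YQ : forall B, measurable B -> P (Y @^-1` B) = Q B)
  (XY : forall A B, measurable A -> measurable B ->
    P (X @^-1` A `&` Y @^-1` B) = P (X @^-1` A) * P (Y @^-1` B)).

(** Uniqueness of product measures identifies the joint law of [(X, Y)] with the law of [X] times
    [Q]; Tonelli's theorem does the rest. *)
Lemma integral_independent_pair (f : T1 * T2 -> \bar R) :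
  measurable_fun setT f -> (forall z, 0 <= f z) ->
  \int[P]_w f (X w, Y w) = \int[P]_w \int[Q]_y f (X w, y).
Proof.
move=> mf f0.
pose X' : {mfun Omega >-> T1} := HB.pack X (isMeasurableFun.Build _ _ _ _ X mX).
have mZ : measurable_fun setT (fun w => (X w, Y w)).
  exact: measurable_fun_pair.
pose Z : {mfun Omega >-> (T1 * T2)%type} :=
  HB.pack (fun w => (X w, Y w)) (isMeasurableFun.Build _ _ _ _ _ mZ).
transitivity (\int[distribution P Z]_z f z).
  by rewrite ge0_integral_distribution.
transitivity (\int[distribution P X' \x Q]_z f z).
  apply: eq_measure_integral => A mA _; apply/esym.
  apply: product_measure_unique => // B C mB mC.
  change (P (X @^-1` B `&` Y @^-1` C) = P (X @^-1` B) * Q C).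
  by rewrite XY// YQ.
rewrite fubini_tonelli1//; apply: ge0_integral_distribution.
- exact: measurable_fun_fubini_tonelli_F.
- by move=> x; apply: integral_ge0.
Qed.

End independent_pair.

(** * The support of a Borel probability on [R^n] *)

Section support.
Context {R : realType} {n : nat} (Xi : probability (borel_rV R n) R).

Lemma borel_open (U : set 'rV[R]_n) : open U ->
  measurable (U : set (borel_rV R n)).
Proof. exact: sub_sigma_algebra. Qed.

Lemma setC_msupportP (d : 'rV[R]_n) : ~ msupport Xi d <->
  exists U : set 'rV[R]_n, [/\ open U, U d & Xi U = 0%E].
Proof.
split => [|[U [oU Ud U0]] /(_ U oU Ud)]; last by rewrite U0 ltxx.
move=> /existsNP[U] /not_implyP[oU] /not_implyP[Ud /negP U0].
exists U; split => //; apply/eqP; rewrite -measure_le0.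
by move: U0; rewrite -leNgt.
Qed.

Lemma open_setC_msupport : open (~` msupport Xi).
Proof.
rewrite openE => d /setC_msupportP[U [oU Ud U0]]; rewrite /interior.
apply: filterS (open_nbhs_nbhs (conj oU Ud)) => e Ue.
by apply/setC_msupportP; exists U.
Qed.

Lemma rV_rat_dense (d : 'rV[R]_n) (e : R) : 0 < e ->
  exists q : 'rV[rat]_n, ball (map_mx ratr q : 'rV[R]_n) e d.
Proof.
move=> e0.
have h i : exists q : rat, `|ratr q - d 0 i| < e.
  have [|q] := @rat_in_itvoo R (d 0 i - e) (d 0 i + e); first lra.
  rewrite in_itv/= => /andP[q1 q2]; exists q; rewrite ltr_norml; lra.
have [f hf] := choice h.
exists (\row_i f i); rewrite -ball_normE /= [ltLHS]/Num.norm /= mx_normrE.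
by apply/bigmax_ltP; split => //= -[i j] _; rewrite !mxE (ord1 i); exact: hf.
Qed.

(** Second countability: the complement is covered by the countably many null balls with rational
    centre and radius [1 / (m + 1)]. *)
Lemma msupport_setC_null : Xi (~` msupport Xi) = 0%E.
Proof.
apply: measure_negligible.
  by apply: borel_open; exact: open_setC_msupport.
pose B (qm : 'rV[rat]_n * nat) : set 'rV[R]_n :=
  ball (map_mx ratr qm.1 : 'rV[R]_n) qm.2.+1%:R^-1.
pose F (k : nat) : set (borel_rV R n) :=
  if unpickle k is Some qm then if Xi (B qm) == 0%E then B qm else set0
  else set0.
apply: (@negligibleS _ _ _ Xi (\bigcup_k F k)).
  move=> d /setC_msupportP[U [oU Ud U0]].
  have /nbhs_ballP[e /= e0 eU] := open_nbhs_nbhs (conj oU Ud).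
  (* Radius below [e / 2]: a ball of this radius that contains [d] lies within the [e]-ball of [d],
     hence in the null set [U]. *)
  have [m me] : exists m : nat, m.+1%:R^-1 < e / 2.
    have [m] := ltr_add_invr (divr_gt0 e0 (ltr0Sn R 1)).
    by rewrite add0r; exists m.
  have [q qd] := @rV_rat_dense d m.+1%:R^-1 (ltac:(by rewrite invr_gt0)).
  exists (pickle (q, m)) => //; rewrite /F pickleK.
  have BU : B (q, m) `<=` U.
    move=> y qy; apply: eU; apply: (@le_ball _ _ _ (m.+1%:R^-1 + m.+1%:R^-1)).
      by rewrite (splitr e) ltW// ltrD.
    by apply: ball_triangle qy; exact: ball_sym.
  rewrite (_ : Xi (B (q, m)) == 0%E)// -measure_le0 -U0.
  apply: le_measure; rewrite ?inE//; apply: borel_open => //.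
  exact: ball_open.
apply: negligible_bigcup => k; rewrite /F.
case: unpickle => [qm|]; last exact: negligible_set0.
case: ifPn => [/eqP B0|_]; last exact: negligible_set0.
exists (B qm); split => //; apply: borel_open; exact: ball_open.
Qed.

End support.

(** * One randomised step, for a fixed direction and on average *)

Section randomised_step.
Context {R : realType} {n : nat}.
Variables (V : 'rV[R]_n -> R) (L : R).
Hypothesis V_smooth : smooth L V.
Implicit Types (x d : 'rV[R]_n).

(** With [s = t alpha] and [g = <grad V x, d>], the update rule says [V x - V x' = s^2 / t]. The
    remainder bound along [d] then reads [|s g - s^2 / t| <= c s^2 / 2], so
    [g^2 <= s^2 (1 / t + c / 2)^2]. In the stationary case both sides vanish. *)
Lemma ria_step_decrease (t c : R) d x x' : 0 < t -> usphere d ->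
  (forall y (a : R),
    `|dotp (grad V (y + a *: d)) d - dotp (grad V y) d| <= c * `|a|) ->
  ria_step V t d x x' ->
  dotp (grad V x) d ^+ 2 <= t * (t^-1 + c / 2) ^+ 2 * (V x - V x').
Proof.
move=> t0 d1 hc [[al [al0 alE x'E]]|[-> ->]]; last first.
  by rewrite subrr mulr0 expr0n.
have [dV _ _] := V_smooth.
have c0 : 0 <= c.
  by have := hc 0 1; rewrite normr1 mulr1; apply: le_trans.
set s := t * al in alE x'E.
have s0 : s != 0 by rewrite mulf_neq0// gt_eqF.
have s2 : 0 < s ^+ 2 by rewrite lt_neqAle eq_sym sqr_ge0 sqrf_eq0 s0.
set g := dotp (grad V x) d.
have VE : V x - V x' = s ^+ 2 / t.
  have alt : al = s / t by rewrite /s mulrC mulKf// gt_eqF.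
  have : V x - V x' = al * s by rewrite alE -x'E mulNr divfK// opprB.
  by rewrite alt mulrAC -expr2.
have [r rE] : exists r, r = - s by exists (- s).
have sr2 : s ^+ 2 = `|r| ^+ 2 by rewrite real_normK ?num_real// rE sqrrN.
have : `|V (x + r *: d) - V x - dotp (grad V x) (r *: d)| <= c * s ^+ 2 / 2.
  apply: first_order_remainder_le => // u u0 u1.
  rewrite !dotpZr -mulrBr normrM scalerA.
  rewrite (le_trans (ler_wpM2l (normr_ge0 _) (hc _ _)))//.
  rewrite normrM (ger0_norm u0) sr2 le_eqVlt; apply/orP; left; apply/eqP; ring.
rewrite dotpZr -/g rE scaleNr -x'E.
have -> : V x' - V x - - s * g = s * g - s ^+ 2 / t by rewrite -VE; ring.
move=> h.
have sg : `|s * g| <= s ^+ 2 * (t^-1 + c / 2).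
  rewrite -[s * g](subrK (s ^+ 2 / t)) (le_trans (ler_normD _ _))//.
  rewrite [`|s ^+ 2 / t|]ger0_norm ?divr_ge0 ?sqr_ge0 ?(ltW t0)//.
  by rewrite mulrDr addrC lerD2l (le_trans h)// mulrA [c * _]mulrC.
have {}sg : s ^+ 2 * g ^+ 2 <= s ^+ 2 * (s ^+ 2 * (t^-1 + c / 2) ^+ 2).
  rewrite -exprMn -(real_normK (num_real (s * g))).
  have -> : s ^+ 2 * (s ^+ 2 * (t^-1 + c / 2) ^+ 2) =
    (s ^+ 2 * (t^-1 + c / 2)) ^+ 2 by ring.
  by rewrite ler_pXn2r// nnegrE (le_trans _ sg).
move: sg; rewrite ler_pM2l// => sg.
rewrite VE (le_trans sg)// le_eqVlt; apply/orP; left; apply/eqP; field.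
by rewrite gt_eqF.
Qed.

End randomised_step.

Section borel_rV.
Context {R : realType} {n : nat}.

Lemma measurable_continuous_rV (f : 'rV[R]_n -> R) : continuous f ->
  measurable_fun setT (f : borel_rV R n -> R).
Proof.
move=> /continuousP cf; apply: (measurability _ (RGenOpens.measurableE R)).
move=> _ [_ [a [b ->] <-]]; rewrite setTI; apply: borel_open.
exact/cf/interval_open.
Qed.

(** Homogeneity reduces the bound to the unit vector [g / |g|], one of those over which [zeta] is
    the minimum. *)
Lemma zeta_le_integral (Xi : probability (borel_rV R n) R) (c : R)
    (g : 'rV[R]_n) : 0 < zeta Xi -> 0 <= c ->
  ((zeta Xi * (c * dotp g g))%:E <=
   \int[Xi]_d (c * dotp g (d : 'rV[R]_n) ^+ 2)%:E)%E.
Proof.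
move=> z0 c0.
have [g0|g0] := eqVneq (dotp g g) 0.
  rewrite g0 !mulr0; apply: integral_ge0 => d _.
  by rewrite lee_fin mulr_ge0 ?sqr_ge0.
have gp : 0 < enorm g.
  by rewrite lt_neqAle enorm_ge0 andbT eq_sym -sqrf_eq0 sqr_enorm.
pose e := (enorm g)^-1 *: g.
have e1 : usphere e.
  by rewrite /usphere /= enormZ ger0_norm ?invr_ge0 ?enorm_ge0// mulVf// gt_eqF.
have [_ zlb] := minimum_neq0 (lt0r_neq0 z0).
have ze : zeta Xi <= fine 'E_Xi[fun d : borel_rV R n => dotp d e ^+ 2].
  by apply: zlb; exists e.
(* Undoes the [fine] in [zeta]: a finite expectation is unchanged, and an infinite one satisfies the
   bound trivially. *)
have zE : ((zeta Xi)%:E <= \int[Xi]_d (dotp (d : 'rV[R]_n) e ^+ 2)%:E)%E.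
  move: ze; rewrite unlock; set I := (integral _ _ _).
  have I0 : (0 <= I)%E.
    by apply: integral_ge0 => d _; rewrite lee_fin sqr_ge0.
  by case: I I0 => [r|//|//] _; [rewrite lee_fin|rewrite leey].
have mdot (v : 'rV[R]_n) :
    measurable_fun setT
      (fun d : borel_rV R n => (dotp (d : 'rV[R]_n) v ^+ 2)%:E).
  apply/measurable_EFinP; apply: measurable_funX.
  apply: measurable_sum => i; apply: measurable_funM => //.
  by apply: measurable_continuous_rV; exact: coord_continuous.
have -> : (\int[Xi]_d (c * dotp g (d : 'rV[R]_n) ^+ 2)%:E =
    (c * dotp g g)%:E * \int[Xi]_d (dotp (d : 'rV[R]_n) e ^+ 2)%:E)%E.
  rewrite -ge0_integralZl_EFin//=.
  - apply: eq_integral => d _; rewrite -EFinM; congr (_%:E).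
    rewrite dotpZr dotpC exprMn exprVn sqr_enorm; field.
    by rewrite -sqr_enorm sqrf_eq0 gt_eqF.
  - by move=> d _; rewrite lee_fin sqr_ge0.
  - by rewrite mulr_ge0// dotp_ge0.
by rewrite mulrC EFinM lee_wpmul2l// lee_fin mulr_ge0// dotp_ge0.
Qed.

End borel_rV.

Section bounded_random_variables.
Context {d : measure_display} {T : measurableType d} {R : realType}
  (P : probability T R).

Lemma integrable_ge0_bounded (f : T -> R) (M : R) : measurable_fun setT f ->
  (forall w, 0 <= f w <= M) -> P.-integrable setT (EFin \o f).
Proof.
move=> mf fM; apply: measurable_bounded_integrable => //.
  by rewrite (le_lt_trans (probability_le1 _ _))// ltry.
exists M; split; first exact: num_real.
move=> x Mx w _; have /andP[f0 fw] := fM w.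
by rewrite /= ger0_norm// (le_trans fw)// ltW.
Qed.

(** Jensen's inequality by its tangent line: integrate [2 a f - a^2 <= f^2] with [a] the mean of
    [f]. *)
Lemma sqr_Rintegral_le (f : T -> R) (M : R) : measurable_fun setT f ->
  (forall w, 0 <= f w <= M) ->
  (\int[P]_w f w) ^+ 2 <= \int[P]_w (f w ^+ 2).
Proof.
move=> mf fM; set a := \int[P]_w f w.
have intf := integrable_ge0_bounded mf fM.
have intf2 : P.-integrable setT (EFin \o (fun w => f w ^+ 2)).
  apply: (@integrable_ge0_bounded _ (M ^+ 2)); first exact: measurable_funX.
  move=> w; have /andP[f0 fw] := fM w; rewrite sqr_ge0/=.
  by rewrite ler_pXn2r ?nnegrE// (le_trans f0).
have intaf : P.-integrable setT (EFin \o (fun w => 2 * a * f w)).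
  exact: (integrableZl measurableT (2 * a) intf).
have intc : P.-integrable setT (EFin \o (fun=> a ^+ 2)).
  exact: finite_measure_integrable_cst.
have <- : \int[P]_w (2 * a * f w - a ^+ 2) = a ^+ 2.
  have cstE : \int[P]_w (a ^+ 2) = a ^+ 2.
    rewrite Rintegral_cst// -[RHS]mulr1; congr (_ * _).
    by rewrite [X in fine X](probability_setT P).
  by rewrite RintegralB// RintegralZl// -/a cstE; ring.
apply: le_Rintegral => //; first exact: (integrableB measurableT intaf intc).
by move=> w _; have := sqr_ge0 (f w - a); nra.
Qed.

End bounded_random_variables.

Section randomised_expected_decrease.
Context {R : realType} {n : nat}.
Variables (V : 'rV[R]_n -> R) (L : R) (x0 : 'rV[R]_n).
Hypotheses (V_smooth : smooth L V)
  (V_convex : convex_function [set: 'rV[R]_n] V) (V_coercive : coercive V).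
Context {disp : measure_display} {Omega : measurableType disp}
  (P : probability Omega R) (Xi : probability (borel_rV R n) R).
Local Notation Vstar := (minimum (range V)).
Local Notation D := (diam [set z | V z <= V x0]).

Lemma measurable_gap (X : Omega -> borel_rV R n) :
  measurable_fun setT X -> measurable_fun setT (fun w => V (X w) - Vstar).
Proof.
move=> mX; apply: measurable_funB => //.
apply: (measurableT_comp _ mX).
by apply: measurable_continuous_rV; exact: smooth_continuous V_smooth.
Qed.

Lemma gap_bounds (x : 'rV[R]_n) : V x <= V x0 ->
  0 <= V x - Vstar <= V x0 - Vstar.
Proof.
move=> xx0; have [xs xsmin ->] := minimizer_exists V_smooth V_coercive.
by rewrite subr_ge0 xsmin lerD2r.
Qed.

Lemma integrable_gap (X : Omega -> borel_rV R n) : measurable_fun setT X ->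
  (forall w, V (X w) <= V x0) ->
  P.-integrable setT (EFin \o (fun w => V (X w) - Vstar)).
Proof.
move=> mX X0; exact: (integrable_ge0_bounded P (measurable_gap mX)
  (fun w => gap_bounds (X0 w))).
Qed.

(** The inner product is expanded into coordinates because each factor then depends on one variable
    only, which gives measurability for the product sigma-algebra. *)
Lemma measurable_dotp_grad (c : R) : measurable_fun setT
  (fun z : borel_rV R n * borel_rV R n =>
    (c * dotp (grad V (z.1 : 'rV[R]_n)) (z.2 : 'rV[R]_n) ^+ 2)%:E).
Proof.
have [_ cg _] := V_smooth.
apply/measurable_EFinP; apply: measurable_funM => //; apply: measurable_funX.
apply: measurable_sum => i.
have mg : measurable_fun setT
    ((fun x : 'rV[R]_n => grad V x 0 i) : borel_rV R n -> R).
  apply: measurable_continuous_rV => x.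
  exact: (continuous_comp (cg x) (@coord_continuous R 1 n 0 i (grad V x))).
have mc : measurable_fun setT ((fun x : 'rV[R]_n => x 0 i) : borel_rV R n -> R).
  by apply: measurable_continuous_rV; exact: coord_continuous.
apply: measurable_funM; first exact: (measurableT_comp mg measurable_fst).
exact: (measurableT_comp mc measurable_snd).
Qed.

(** Jensen, then [sqr_gap_le] and the definition of [zeta] for frozen [X], bound the left side by
    the iterated integral of [D^2 <grad V X, y>^2]; by independence [y] may be replaced by [Y],
    where [dec] applies. *)
Lemma randomised_expected_decrease (X X' Y : Omega -> borel_rV R n) (c : R) :
  0 < zeta Xi -> 0 <= c ->
  measurable_fun setT X -> measurable_fun setT X' -> measurable_fun setT Y ->
  (forall B, measurable B -> P (Y @^-1` B) = Xi B) ->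
  (forall A B, measurable A -> measurable B ->
    P (X @^-1` A `&` Y @^-1` B) = (P (X @^-1` A) * P (Y @^-1` B))%E) ->
  (forall w, V (X w) <= V x0) -> (forall w, V (X' w) <= V (X w)) ->
  {ae P, forall w,
    dotp (grad V (X w)) (Y w) ^+ 2 <= c * (V (X w) - V (X' w))} ->
  zeta Xi * (\int[P]_w (V (X w) - Vstar)) ^+ 2 <=
  D ^+ 2 * c * (\int[P]_w (V (X w) - Vstar) - \int[P]_w (V (X' w) - Vstar)).
Proof.
move=> z0 c0 mX mX' mY YXi XY X0 X'X dec.
have X'0 w : V (X' w) <= V x0 := le_trans (X'X w) (X0 w).
have iX := integrable_gap mX X0; have iX' := integrable_gap mX' X'0.
have mgX := measurable_gap mX; have mgX' := measurable_gap mX'.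
pose gap w := V (X w) - Vstar; pose gap' w := V (X' w) - Vstar.
pose f (z : borel_rV R n * borel_rV R n) :=
  (D ^+ 2 * dotp (grad V (z.1 : 'rV[R]_n)) (z.2 : 'rV[R]_n) ^+ 2)%:E.
have f0 z : (0 <= f z)%E by rewrite lee_fin mulr_ge0 ?sqr_ge0.
have mf : measurable_fun setT f := measurable_dotp_grad (D ^+ 2).
have igap2 : P.-integrable setT (EFin \o (fun w => gap w ^+ 2)).
  apply: (@integrable_ge0_bounded _ _ _ _ _ ((V x0 - Vstar) ^+ 2)).
    exact: measurable_funX.
  move=> w; have /andP[g0 gw] := gap_bounds (X0 w); rewrite sqr_ge0/=.
  by rewrite ler_pXn2r ?nnegrE// (le_trans g0).
have step1 : ((zeta Xi * (\int[P]_w gap w) ^+ 2)%:E <=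
    \int[P]_w \int[Xi]_y f (X w, y))%E.
  apply: (@le_trans _ _ (\int[P]_w (zeta Xi * gap w ^+ 2)%:E)%E).
    rewrite -[leRHS]fineK; last first.
      apply: integrable_fin_num => //.
      exact: (integrableZl measurableT (zeta Xi) igap2).
    rewrite lee_fin -[leRHS]/(\int[P]_w (zeta Xi * gap w ^+ 2)) RintegralZl//.
    rewrite ler_wpM2l ?(ltW z0)//.
    exact: (sqr_Rintegral_le P mgX (fun w => gap_bounds (X0 w))).
  apply: ge0_le_integral => //.
  - by move=> w _; rewrite lee_fin mulr_ge0 ?sqr_ge0// ltW.
  - apply/measurable_EFinP; apply: measurable_funM => //.
    exact: measurable_funX.
  - have mF := @measurable_fun_fubini_tonelli_F _ _ _ _ _ Xi f mf f0.
    exact: (measurableT_comp mF mX).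
  - move=> w _; apply: (@le_trans _ _
      (zeta Xi * (D ^+ 2 * dotp (grad V (X w)) (grad V (X w))))%:E).
      rewrite lee_fin ler_wpM2l ?(ltW z0)//.
      exact: sqr_gap_le V_smooth V_convex V_coercive _ _ (X0 w).
    by apply: zeta_le_integral; rewrite ?sqr_ge0.
have step2 : (\int[P]_w \int[Xi]_y f (X w, y) <=
    \int[P]_w (D ^+ 2 * c * (gap w - gap' w))%:E)%E.
  rewrite -(integral_independent_pair mX mY YXi XY mf f0).
  apply: ae_ge0_le_integral => //.
  - exact: (measurableT_comp mf (measurable_fun_pair mX mY)).
  - move=> w _; rewrite lee_fin; apply: mulr_ge0.
      by rewrite mulr_ge0 ?sqr_ge0.
    by rewrite subr_ge0 /gap /gap' lerD2r.
  - apply/measurable_EFinP; apply: measurable_funM => //.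
    exact: measurable_funB.
  - apply: filterS dec => w h _; rewrite lee_fin -mulrA ler_wpM2l ?sqr_ge0//.
    by rewrite (le_trans h)// /gap /gap' opprB addrA subrK.
have iB : P.-integrable setT (EFin \o (fun w => gap w - gap' w)).
  exact: (integrableB measurableT iX iX').
have := le_trans step1 step2; rewrite -[leRHS]fineK; last first.
  apply: integrable_fin_num => //.
  exact: (integrableZl measurableT (D ^+ 2 * c) iB).
rewrite lee_fin -[leRHS]/(\int[P]_w (D ^+ 2 * c * (gap w - gap' w))).
by rewrite RintegralZl// RintegralB.
Qed.

End randomised_expected_decrease.

(** * Assembling the rates *)

Section discrete_gradient_rate.
Context {R : realType} {n : nat}.
Variables (V : 'rV[R]_n -> R) (L : R) (x0 : 'rV[R]_n).
Hypotheses (L_gt0 : 0 < L) (V_smooth : smooth L V)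
  (V_convex : convex_function [set: 'rV[R]_n] V) (V_coercive : coercive V).
Variables (tau : nat -> R) (tau_min tau_max : R).
Hypotheses (tau_min_gt0 : 0 < tau_min)
  (tau_bounds : forall k, tau_min <= tau k <= tau_max).
Local Notation Vstar := (minimum (range V)).
Local Notation D := (diam [set z | V z <= V x0]).

Lemma tau_gt0 k : 0 < tau k.
Proof. by have /andP[t0 _] := tau_bounds k; exact: lt_le_trans t0. Qed.

Lemma discrete_gradient_rate (dg : 'rV[R]_n -> 'rV[R]_n -> 'rV[R]_n) (K : R)
    (x : nat -> 'rV[R]_n) : 0 <= K ->
  (forall y z, dotp (dg y z) (z - y) = V z - V y) ->
  (forall y z, dotp (dg y z - grad V y) (dg y z - grad V y) <=
    K * dotp (z - y) (z - y)) ->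
  dg_iterates dg tau x0 x ->
  forall k, V (x k) - Vstar <=
    rate L D (fun k => 2 * ((tau k)^-1 + K * tau k)) k.
Proof.
move=> K0 mv err [x00 xS]; apply: rate_of_sufficient_decrease => // [k||k].
- by rewrite mulr_gt0// ltr_wpDr ?invr_gt0 ?mulr_ge0// ?ltW ?tau_gt0.
- exists (2 * (tau_min^-1 + K * tau_max)) => _ [k _ <-].
  have /andP[t1 t2] := tau_bounds k.
  by rewrite ler_pM2l// lerD ?ler_wpM2l// lef_pV2 ?posrE ?tau_gt0.
- exact: (sufficient_decrease (tau_gt0 k) (xS k)).
Qed.

Section randomised_itoh_abe.
Context {disp : measure_display} {Omega : measurableType disp}
  (P : probability Omega R) (Xi : probability (borel_rV R n) R).
Variables (Ld : 'rV[R]_n -> R) (dir : nat -> {RV P >-> borel_rV R n})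
  (x : nat -> Omega -> borel_rV R n).
Hypotheses (Xi_sphere : Xi (@usphere R n) = 1%E) (zeta_gt0 : 0 < zeta Xi)
  (LdL : forall d, usphere d -> Ld d <= L)
  (Ld_lip : forall (d y : 'rV[R]_n) (a : R), usphere d ->
    `|dotp (grad V (y + a *: d)) d - dotp (grad V y) d| <= Ld d * `|a|)
  (dir_sphere : forall k w, usphere (dir k w))
  (dir_law : forall k A, measurable A -> distribution P (dir k) A = Xi A)
  (dir_indep : mutually_independent P (fun k => dir k))
  (x_iter : ria_iterates V tau (fun k => dir k) x0 x).
Let Lmax := sup [set Ld d | d in msupport Xi].

(** The complement of the sphere is open and null, so none of its points is in the support. *)
Lemma msupport_sphere : msupport Xi `<=` @usphere R n.
Proof.
move=> d; apply: contraPP => dS /(_ (~` @usphere R n)).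
have cS : closed (@usphere R n).
  have -> : @usphere R n = (fun d => dotp d d) @^-1` [set 1].
    apply/seteqP; split=> e /=; rewrite /usphere /= -sqr_enorm => h.
      by rewrite h expr1n.
    by apply/eqP; rewrite -(@eqrXn2 _ 2) ?enorm_ge0 ?expr1n ?h.
  apply: closed_comp (@closed_eq R 1) => e _.
  apply: continuous_big => [|i _ u]; first exact: add_continuous.
  have cu := @coord_continuous R 1 n 0 i u; exact: (cvgM cu cu).
move=> /(_ (closed_openC cS) dS).
have mS : measurable (@usphere R n : set (borel_rV R n)).
  rewrite -[X in measurable X]setCK; apply: measurableC.
  by apply: borel_open; exact: closed_openC.
by rewrite probability_setC// Xi_sphere subee// ltxx.
Qed.

Lemma Ld_ge0 d : usphere d -> 0 <= Ld d.
Proof.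
by move=> dS; have := Ld_lip 0 1 dS; rewrite normr1 mulr1; apply: le_trans.
Qed.

Lemma Ld_le_Lmax d : msupport Xi d -> Ld d <= Lmax.
Proof.
move=> sd; apply: ub_le_sup; last by exists d.
by exists L => _ [e se <-]; exact/LdL/msupport_sphere.
Qed.

(** The support is nonempty, its complement being null, and [Ld] is nonnegative at any of its
    points. *)
Lemma Lmax_ge0 : 0 <= Lmax.
Proof.
have [d sd] : msupport Xi !=set0.
  apply/set0P/eqP => s0; have := msupport_setC_null Xi.
  rewrite s0 setC0 probability_setT => /eqP.
  by rewrite eqe oner_eq0.
exact: le_trans (Ld_ge0 (msupport_sphere sd)) (Ld_le_Lmax sd).
Qed.

Lemma dir_ae_msupport k : {ae P, forall w, msupport Xi (dir k w)}.
Proof.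
have mS : measurable (~` msupport Xi : set (borel_rV R n)).
  by apply: borel_open; exact: open_setC_msupport.
exists (dir k @^-1` (~` msupport Xi)); split => //.
- by rewrite -[X in measurable X]setTI; exact: measurable_funP.
- by rewrite -[LHS]/(distribution P (dir k) (~` msupport Xi)) dir_law//
    msupport_setC_null.
Qed.

(** With the constant [Ld (dir k w)] of the direction itself, the descent holds for every outcome
    and not merely almost surely. *)
Lemma ria_decrease k w : V (x k.+1 w) <= V (x k w).
Proof.
have [_ _ xS] := x_iter; have dS := dir_sphere k w.
have := ria_step_decrease V_smooth (tau_gt0 k) dS
  (fun y a => Ld_lip y a dS) (xS k w).
move=> /(le_trans (sqr_ge0 _)); rewrite pmulr_rge0 ?subr_ge0//.
rewrite mulr_gt0 ?tau_gt0// exprn_gt0// ltr_wpDr ?invr_gt0 ?tau_gt0//.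
by rewrite divr_ge0// Ld_ge0.
Qed.

Lemma ria_le_init k w : V (x k w) <= V x0.
Proof.
have [x00 _ _] := x_iter.
by elim: k => [|k ih]; [rewrite x00|exact: le_trans (ria_decrease k w) ih].
Qed.

Lemma dir_measurable k : measurable_fun setT (dir k).
Proof. exact: measurable_funP. Qed.

Lemma ria_measurable k : measurable_fun setT (x k).
Proof.
have [_ xm _] := x_iter => _ A mA; rewrite setTI.
apply: (g_sigma_preimage_measurable (X := fun k => dir k)); last exact: xm.
exact: dir_measurable.
Qed.

Lemma ria_ae_sufficient_decrease k : {ae P, forall w,
  dotp (grad V (x k w)) (dir k w) ^+ 2 <=
  tau k * ((tau k)^-1 + Lmax / 2) ^+ 2 * (V (x k w) - V (x k.+1 w))}.
Proof.
have [_ _ xS] := x_iter.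
apply: filterS (dir_ae_msupport k) => w sw; have dS := dir_sphere k w.
rewrite (le_trans (ria_step_decrease V_smooth (tau_gt0 k) dS
  (fun y a => Ld_lip y a dS) (xS k w)))//.
rewrite ler_wpM2r ?subr_ge0 ?ria_decrease// ler_wpM2l ?(ltW (tau_gt0 k))//.
have i0 : 0 <= (tau k)^-1 by rewrite invr_ge0 ltW// tau_gt0.
have l0 : 0 <= Ld (dir k w) by exact: Ld_ge0.
have lm := Ld_le_Lmax sw.
by rewrite ler_pXn2r ?nnegrE ?addr_ge0 ?divr_ge0 ?Lmax_ge0// lerD2l ler_wpM2r.
Qed.

Let a k := \int[P]_w (V (x k w) - Vstar).

Lemma ria_recurrence k : zeta Xi * a k ^+ 2 <=
  D ^+ 2 * (tau k * ((tau k)^-1 + Lmax / 2) ^+ 2) * (a k - a k.+1).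
Proof.
apply: (randomised_expected_decrease V_smooth V_convex V_coercive
  (X := x k) (X' := x k.+1) (Y := dir k)) => //.
- by rewrite mulr_ge0 ?sqr_ge0// ltW// tau_gt0.
- exact: ria_measurable.
- exact: ria_measurable.
- exact: dir_law.
(* The events of [x k] lie in the sigma-algebra of the first [k] directions, of which [dir k] is
   independent. *)
- move=> A B mA mB; have [_ xm _] := x_iter.
  apply: (independent_past (X := fun k => dir k)) => //; last exact: xm.
- exact: ria_le_init.
- exact: ria_decrease.
- exact: ria_ae_sufficient_decrease.
Qed.

Lemma beta_ria_gt0 k : 0 < beta_ria (zeta Xi) Lmax tau k.
Proof.
rewrite /beta_ria mulr_gt0 ?divr_gt0 ?tau_gt0// exprn_gt0//.
by rewrite ltr_wpDr ?invr_gt0 ?tau_gt0// divr_ge0 ?Lmax_ge0.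
Qed.

Lemma beta_ria_le_sup k :
  beta_ria (zeta Xi) Lmax tau k <= sup (range (beta_ria (zeta Xi) Lmax tau)).
Proof.
apply: ub_le_sup; last by exists k.
exists (tau_max / zeta Xi * (tau_min^-1 + Lmax / 2) ^+ 2) => _ [j _ <-].
have /andP[t1 t2] := tau_bounds j; have t0 := tau_gt0 j.
have l0 := Lmax_ge0.
have z0 : 0 <= (zeta Xi)^-1 by rewrite invr_ge0 ltW.
have i0 : 0 <= (tau j)^-1 by rewrite invr_ge0 ltW.
have im : 0 <= tau_min^-1 by rewrite invr_ge0 ltW.
apply: ler_pM; rewrite ?sqr_ge0 ?mulr_ge0 ?(ltW t0) ?ler_wpM2r//.
by rewrite ler_pXn2r ?nnegrE ?addr_ge0 ?divr_ge0// lerD2r lef_pV2 ?posrE.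
Qed.

Lemma ria_gap_le k : a k <= rate L D (beta_ria (zeta Xi) Lmax tau) k.
Proof.
(* This sign allows [beta_ria] at [j] to be replaced by the supremum. *)
have anti j : a j.+1 <= a j.
  apply: le_Rintegral => //.
  - exact: (integrable_gap V_smooth V_coercive P (ria_measurable _)
      (ria_le_init _)).
  - exact: (integrable_gap V_smooth V_coercive P (ria_measurable _)
      (ria_le_init _)).
  - by move=> w _; rewrite lerD2r ria_decrease.
apply: rate_of_recurrence => //.
- exact: lt_le_trans (beta_ria_gt0 0) (beta_ria_le_sup 0).
- move=> j; apply: Rintegral_ge0 => w _.
  by have /andP[] := gap_bounds V_smooth V_coercive (ria_le_init j w).
- have [x00 _ _] := x_iter.
  have -> : a 0%N = V x0 - Vstar.
    rewrite /a; under eq_Rintegral do rewrite x00.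
    rewrite Rintegral_cst// -[RHS]mulr1; congr (_ * _).
    by rewrite [X in fine X](probability_setT P).
  exact: initial_gap_le.
- move=> j; have bj := beta_ria_le_sup j.
  apply: (@le_trans _ _
    (beta_ria (zeta Xi) Lmax tau j * D ^+ 2 * (a j - a j.+1))).
    rewrite -(ler_pM2l zeta_gt0) (le_trans (ria_recurrence j))// /beta_ria.
    rewrite le_eqVlt; apply/orP; left; apply/eqP; field.
    by rewrite !gt_eqF ?tau_gt0.
  by rewrite ler_wpM2r ?subr_ge0// ler_wpM2r ?sqr_ge0.
Qed.

(** The gap is bounded, hence integrable, so the expectation of [V] is finite and [Vstar] can be
    subtracted from it. *)
Lemma ria_rate k : ('E_P[fun w => V (x k w)] - Vstar%:E <=
  (rate L D (beta_ria (zeta Xi) Lmax tau) k)%:E)%E.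
Proof.
have ig := integrable_gap V_smooth V_coercive P (ria_measurable k)
  (ria_le_init k).
have ic : P.-integrable setT (EFin \o (fun=> Vstar)).
  exact: finite_measure_integrable_cst.
have -> : ('E_P[fun w => V (x k w)] = (a k + Vstar)%:E)%E.
  rewrite unlock.
  under eq_integral do rewrite -[V _](subrK Vstar) EFinD.
  rewrite integralD_EFin// integral_cst//.
  rewrite [X in (_ + _ * X)%E](probability_setT P).
  rewrite mule1.
  rewrite EFinD; congr (_ + _)%E; rewrite /a /Rintegral fineK//.
  exact: integrable_fin_num.
by rewrite -EFinB addrK lee_fin ria_gap_le.
Qed.

End randomised_itoh_abe.

End discrete_gradient_rate.

Theorem theorem6p4 (R : realType) (n : nat) (V : 'rV[R]_n -> R) (L : R)
    (x0 : 'rV[R]_n) (tau : nat -> R) (tau_min tau_max : R)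
    (L_gt0 : 0 < L) (V_smooth : smooth L V)
    (V_convex : convex_function [set: 'rV[R]_n] V) (V_coercive : coercive V)
    (tau_min_gt0 : 0 < tau_min) (tau_min_max : tau_min <= tau_max)
    (tau_bounds : forall k, tau_min <= tau k <= tau_max) :
  let Vstar := minimum (range V) in
  let D := diam [set x | V x <= V x0] in
  [/\ (forall x : nat -> 'rV[R]_n, dg_iterates (gonzalez V) tau x0 x ->
        forall k, V (x k) - Vstar <= rate L D (beta_gonzalez L tau) k),
      (forall x : nat -> 'rV[R]_n, dg_iterates (mean_value V) tau x0 x ->
        forall k, V (x k) - Vstar <= rate L D (beta_mean_value L tau) k),
      (forall (Lbar : 'I_n -> R) (x : nat -> 'rV[R]_n),
        (forall i, Lbar i <= L) ->
        (forall i y z,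
          `|partial V i y - partial V i z| <= Lbar i * enorm (y - z)) ->
        dg_iterates (itoh_abe V) tau x0 x ->
        let Lsum := Num.sqrt (\sum_(i < n) Lbar i ^+ 2) in
        forall k, V (x k) - Vstar <= rate L D (beta_itoh_abe Lsum tau) k) &
      (forall (Xi : probability (borel_rV R n) R) (Ld : 'rV[R]_n -> R)
          (disp : measure_display) (Omega : measurableType disp)
          (P : probability Omega R) (dir : nat -> {RV P >-> borel_rV R n})
          (x : nat -> Omega -> borel_rV R n),
        Xi (@usphere R n) = 1%E ->
        0 < zeta Xi ->
        (forall d, usphere d -> Ld d <= L) ->
        (forall (d y : 'rV[R]_n) (a : R), usphere d ->
          `|dotp (grad V (y + a *: d)) d - dotp (grad V y) d| <= Ld d * `|a|) ->
        (forall k w, usphere (dir k w)) ->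
        (forall k A, measurable A -> distribution P (dir k) A = Xi A) ->
        mutually_independent P (fun k => dir k) ->
        ria_iterates V tau (fun k => dir k) x0 x ->
        let Lmax := sup [set Ld d | d in msupport Xi] in
        forall k, ('E_P[fun w => V (x k w)] - Vstar%:E <=
                   (rate L D (beta_ria (zeta Xi) Lmax tau) k)%:E)%E)].
Proof.
move=> Vstar D; split.
- move=> x hx k.
  have -> : beta_gonzalez L tau =
      (fun k => 2 * ((tau k)^-1 + L ^+ 2 / 2 * tau k)).
    by apply/funext => j; rewrite /beta_gonzalez mulrAC.
  apply: (discrete_gradient_rate L_gt0 V_smooth V_convex V_coercive
    tau_min_gt0 tau_bounds _ (gonzalez_mean_value V)
    (gonzalez_error V_smooth) hx).
  by rewrite divr_ge0 ?sqr_ge0.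
- move=> x hx k.
  have -> : beta_mean_value L tau =
      (fun k => 2 * ((tau k)^-1 + L ^+ 2 / 4 * tau k)).
    by apply/funext => j; rewrite /beta_mean_value mulrAC.
  apply: (discrete_gradient_rate L_gt0 V_smooth V_convex V_coercive
    tau_min_gt0 tau_bounds _ (mean_value_mean_value V_smooth)
    (mean_value_error L_gt0 V_smooth) hx).
  by rewrite divr_ge0 ?sqr_ge0.
- move=> Lbar x _ hL hx Lsum k.
  exact: (discrete_gradient_rate L_gt0 V_smooth V_convex V_coercive
    tau_min_gt0 tau_bounds (sqr_ge0 Lsum) (itoh_abe_mean_value V)
    (fun y z => itoh_abe_error V_smooth y z hL) hx).
- move=> Xi Ld disp Omega P dir x Xi1 z0 LdL hLd dirS law ind hx Lmax k.
  exact: (ria_rate L_gt0 V_smooth V_convex V_coercive tau_min_gt0 tau_bounds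
    Xi1 z0 LdL hLd dirS law ind hx).
Qed.
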